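(* Let $G$ and $H$ be two graphs with the same principal main eigenvectors (i.e. the set of principal main eigenvectors of $G$ equals that of $H$) but different main eigenvalues (i.e. the set of main eigenvalues of $G$ differs from that of $H$). Then $\mathbf W_G(k)\neq\mathbf W_H(k)$ for all $k\geq 2$.
   Context: All graphs are finite, simple and undirected, with vertex set $\{1,\dots,n\}$; the adjacency matrix $\mathbf A=\mathbf A(G)$ is the symmetric $n\times n$ $(0,1)$-matrix with $(i,j)$ entry $1$ iff $\{i,j\}$ is an edge. Eigenvalues and eigenvectors of $G$ are those of $\mathbf A$. Let $\mathbf j=(1,\dots,1)^T\in\mathbb R^n$. An eigenvalue of $G$ is main if it has an associated eigenvector not orthogonal to $\mathbf j$. For a main eigenvalue $\mu$, with $\mathbf P_\mu$ the orthogonal projection of $\mathbb R^n$ onto the eigenspace $\{\mathbf x\in\mathbb R^n:\mathbf A\mathbf x=\mu\mathbf x\}$, the vector $\mathbf P_\mu\mathbf j$ is the principal main eigenvector corresponding to $\mu$. The $k$-walk matrix $\mathbf W_G(k)$ is the $n\times k$ matrix whose columns are $\mathbf j,\mathbf A\mathbf j,\dots,\mathbf A^{k-1}\mathbf j$. The vertices of the graphs carry fixed labels $1,\dots,n$, and matrices and vectors are compared entrywise. *)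

(* Defs.v *)
From mathcomp Require Import all_boot all_order all_algebra.
From mathcomp Require Import boolp classical_sets reals.

Set Implicit Arguments.
Unset Strict Implicit.
Unset Printing Implicit Defensive.

Import Order.TTheory GRing.Theory Num.Theory.

Local Open Scope classical_set_scope.
Local Open Scope ring_scope.

Record graph (n : nat) := Graph {
  edge :> rel 'I_n;
  edge_sym : symmetric edge;
  edge_irr : irreflexive edge
}.

Section MainEigen.
Context (R : realType) (n : nat).

Definition adjacency (G : graph n) : 'M[R]_n :=
  \matrix_(i, j) (G i j)%:R.

Definition allone : 'cV[R]_n := const_mx 1.

Definition main_eigenvalues (G : graph n) : set R :=
  [set mu | exists x : 'cV[R]_n,
     [/\ x != 0, adjacency G *m x = mu *: x & x^T *m allone != 0]].

(* [orthomx idfun 1%:M U] is the orthogonal complement of the row space of [U]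
   for the standard inner product, and [proj_mx] acts on row vectors by right
   multiplication; the outer transpose makes the projection act on columns. *)
Definition orth_proj (U : 'M[R]_n) : 'M[R]_n :=
  (proj_mx U (orthomx idfun 1%:M U))^T.

(* The rows of [eigenspace M^T mu] span the transposes of the column vectors
   [x] such that [M *m x = mu *: x]. *)
Definition eigenproj (G : graph n) (mu : R) : 'M[R]_n :=
  orth_proj (eigenspace (adjacency G)^T mu).

Definition principal_main_eigenvectors (G : graph n) : set 'cV[R]_n :=
  [set eigenproj G mu *m allone | mu in main_eigenvalues G].

Definition walk_matrix (G : graph n) (k : nat) : 'M[R]_(n, k) :=
  \matrix_(i < n, l < k) (adjacency G ^+ l *m allone) i 0.

End MainEigen.

Arguments adjacency R {n} G.
Arguments allone R n : clear implicits.
Arguments main_eigenvalues R {n} G.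
Arguments eigenproj {R n} G mu.
Arguments principal_main_eigenvectors R {n} G.
Arguments walk_matrix R {n} G k.

(* Main.v *)
Require Import Defs.
From mathcomp Require Import all_boot all_order all_algebra.
From mathcomp Require Import boolp classical_sets reals.

(** If [v] is the principal main eigenvector of [mu], then the symmetry of the
    adjacency matrix [A] gives [<v, A j> = mu <v, j>], and [<v, j> = |v|^2] is
    nonzero. So [mu] is determined by [v] and the second column [A j] of the
    walk matrix: equal principal main eigenvectors and equal walk matrices
    force equal main eigenvalues. *)

Set Implicit Arguments.
Unset Strict Implicit.
Unset Printing Implicit Defensive.

Import Order.TTheory GRing.Theory Num.Theory.

Local Open Scope classical_set_scope.
Local Open Scope ring_scope.

Lemma mulmx_tr_eq0 (R : realDomainType) (n : nat) (x : 'rV[R]_n) :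
  x *m x^T = 0 -> x = 0.
Proof.
move=> /matrixP/(_ 0 0); rewrite !mxE => /eqP.
under eq_bigr do rewrite mxE.
rewrite psumr_eq0 => [/allP x2_0|i _]; last exact: sqr_ge0.
apply/rowP => i; rewrite mxE; apply/eqP.
by have := x2_0 i (mem_index_enum i); rewrite -expr2 sqrf_eq0.
Qed.

Section OrthProj.
Context (R : realType) (n : nat).
Implicit Types U : 'M[R]_n.

Lemma sub_orthomxP m (W : 'M[R]_(m, n)) U :
  reflect (W *m U^T = 0) (W <= orthomx idfun 1%:M U)%MS.
Proof. by apply: (iffP sub_kermxP); rewrite mul1mx map_mx_id. Qed.

(** A common row [x] is orthogonal to itself, since [x = y *m U] while [x *m U^T = 0]; positive
    definiteness then kills it. *)
Lemma cap_orthomx U : (U :&: orthomx idfun 1%:M U)%MS = 0.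
Proof.
apply/eqP/rowV0P => x; rewrite sub_capmx => /andP[xU /sub_orthomxP xU0].
apply: mulmx_tr_eq0; have [y xE] := submxP xU.
by rewrite {2}xE trmx_mul mulmxA xU0 mul0mx.
Qed.

(** Dimension count: the complement has rank [n - \rank U] and meets [U] trivially, so the sum is
    the whole space. *)
Lemma adds_orthomx m (W : 'M[R]_(m, n)) U :
  (W <= U + orthomx idfun 1%:M U)%MS.
Proof.
apply: submx_full; rewrite /row_full mxrank_disjoint_sum ?cap_orthomx //.
by rewrite /orthomx mul1mx map_mx_id // mxrank_ker mxrank_tr subnKC ?rank_leq_row.
Qed.

Lemma orth_proj_sub U (v : 'cV[R]_n) : ((orth_proj U *m v)^T <= U)%MS.
Proof. by rewrite trmx_mul trmxK proj_mx_sub. Qed.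

Lemma orth_projE U (x v : 'cV[R]_n) :
  (x^T <= U)%MS -> x^T *m (orth_proj U *m v) = x^T *m v.
Proof.
case/submxP=> y ->; apply/eqP; rewrite eq_sym -subr_eq0 -mulmxBr; apply/eqP.
(* The residual of [v^T] after projection lies in the orthogonal complement, so pairing it with a
   row of [U] gives 0. *)
have /sub_orthomxP := proj_mx_compl_sub (adds_orthomx v^T U).
move/(congr1 trmx); rewrite trmx_mul trmxK trmx0 linearB /= trmx_mul trmxK.
by rewrite -mulmxA => ->; rewrite mulmx0.
Qed.

End OrthProj.

Section MainEigenvectors.
Context (R : realType) (n : nat).
Implicit Types G H : graph n.

Lemma tr_adjacency G : (adjacency R G)^T = adjacency R G.
Proof. by apply/matrixP => i j; rewrite !mxE edge_sym. Qed.

Lemma eigenspace_adjacencyP G mu (x : 'cV[R]_n) :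
  reflect (adjacency R G *m x = mu *: x)
          (x^T <= eigenspace (adjacency R G)^T mu)%MS.
Proof.
apply: (iffP eigenspaceP) => [/(congr1 trmx)|/(congr1 trmx)].
  by rewrite trmx_mul !trmxK linearZ /= trmxK.
by rewrite trmx_mul linearZ.
Qed.

Lemma principal_dot_adjacency G mu (v := eigenproj G mu *m allone R n) :
  v^T *m (adjacency R G *m allone R n) = mu *: (v^T *m allone R n).
Proof.
have /eigenspaceP vE := orth_proj_sub (eigenspace (adjacency R G)^T mu)
  (allone R n).
by rewrite mulmxA -[adjacency R G]tr_adjacency vE scalemxAl.
Qed.

(** Projecting [j] inside the product turns [<v, j>] into [<v, v>]. Were it zero, [v] would vanish,
    and the eigenvector [x] witnessing that [mu] is main would satisfy [<x, j> = <x, v> = 0]. *)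
Lemma principal_dot_allone_neq0 G mu (v := eigenproj G mu *m allone R n) :
  main_eigenvalues R G mu -> v^T *m allone R n != 0.
Proof.
case=> x [_ /eigenspace_adjacencyP xE xj].
have vE := orth_proj_sub (eigenspace (adjacency R G)^T mu) (allone R n).
rewrite -(orth_projE _ vE); apply: contraNneq xj => vv0.
have v0 : v^T = 0 by apply: mulmx_tr_eq0; rewrite trmxK.
by rewrite -(orth_projE _ xE) -/(eigenproj G mu) -/v -[v]trmxK v0 trmx0 mulmx0.
Qed.

Lemma sub_main_eigenvalues G H :
  adjacency R G *m allone R n = adjacency R H *m allone R n ->
  principal_main_eigenvectors R G `<=` principal_main_eigenvectors R H ->
  main_eigenvalues R G `<=` main_eigenvalues R H.
Proof.
move=> eqAj sGH mu muG; have [|nu nuH eqv] := sGH (eigenproj G mu *m allone R n).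
  by exists mu.
suff -> : mu = nu by [].
(* The shared vector [v] and the shared [A j] evaluate [<v, A j>] in two ways, so
   [nu <v, j> = mu <v, j>]; the nonzero factor cancels. *)
have /= := principal_dot_adjacency G mu.
rewrite eqAj -eqv principal_dot_adjacency => /eqP.
rewrite -subr_eq0 -scalerBl scaler_eq0 subr_eq0.
by rewrite (negPf (principal_dot_allone_neq0 nuH)) orbF => /eqP.
Qed.

(** Columns are numbered from 0, so [A j] sits at index 1, which exists exactly when [k] is at least
    2. *)
Lemma adjacency_allone_walk_matrix G k (k_gt1 : (1 < k)%N) :
  adjacency R G *m allone R n = col (Ordinal k_gt1) (walk_matrix R G k).
Proof. by apply/colP => i; rewrite !mxE. Qed.

End MainEigenvectors.

Theorem proposition5p3 (R : realType) (n : nat) (G H : graph n)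
    (same_vectors :
       principal_main_eigenvectors R G = principal_main_eigenvectors R H)
    (diff_values : main_eigenvalues R G <> main_eigenvalues R H)
    (k : nat) (k_ge2 : (2 <= k)%N) :
  walk_matrix R G k <> walk_matrix R H k.
Proof.
move=> eqW; apply: diff_values.
have eqAj : adjacency R G *m allone R n = adjacency R H *m allone R n.
  by rewrite !(adjacency_allone_walk_matrix _ _ k_ge2) eqW.
by apply/seteqP; split; apply: sub_main_eigenvalues; rewrite ?same_vectors.
Qed.
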